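(* Let $p$ be a prime and let $\mathcal E$ be a semisaturated fusion system on a finite $p$-group $P$. Then a main essential collection always exists (possibly empty). Moreover, for any main essential collection $\mathfrak E$, we have $\mathcal E=\langle \mathrm{Aut}_{\mathcal E}(Q)\mid Q\in\mathfrak E\text{ or }Q=P\rangle$, i.e. every morphism of $\mathcal E$ is a composition of restrictions of automorphisms in $\mathrm{Aut}_{\mathcal E}(Q)$ with $Q\in\mathfrak E$ or $Q=P$.
   Context: All groups are finite and maps are written on the right. Fusion systems and saturated fusion systems on finite $p$-groups are understood in the standard sense. Semisaturated: a fusion system $\mathcal E$ on a $p$-group $P$ is semisaturated if there exist a $p$-group $S\ge P$ and a saturated fusion system $\mathcal F\ge\mathcal E$ on $S$ such that $P$ is strongly $\mathcal F$-closed (i.e. $x\phi\in P$ for all $x\in P$, $\phi\in\mathrm{Hom}_{\mathcal F}(\langle x\rangle,S)$) and $\mathcal E=\mathcal F_{|\le P}$, i.e. $\mathrm{Hom}_{\mathcal E}(A,B)=\mathrm{Hom}_{\mathcal F}(A,B)$ for all $A,B\le P$. For a fusion system $\mathcal E$ on $P$: $Q^{\mathcal E}$ denotes the set of $\mathcal E$-conjugates of $Q$; $c_x$ denotes conjugation by $x$. $Q\le P$ is fully ($\mathcal E$-)normalized if $|N_P(Q)|\ge|N_P(R)|$ for all $R\in Q^{\mathcal E}$. For $Q\le P$, $\phi\in\mathrm{Hom}_{\mathcal E}(Q,P)$, put $$N_\phi(Q)=\{x\in N_P(Q)\mid \exists\, y\in N_P(Q\phi)\text{ such that }\phi^{-1}c_x\phi=c_y\text{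 on }Q\phi\}.$$ $Q$ is receptive if every $\mathcal E$-isomorphism $\phi:R\to Q$ extends to some $\overline\phi\in\mathrm{Hom}_{\mathcal E}(N_\phi(R),P)$. A proper subgroup $R<P$ is reproductive, written $R\in\mathcal E^r$, if $R$ is receptive and for each $Q\in R^{\mathcal E}$ there exists $\psi\in\mathrm{Hom}_{\mathcal E}(Q,R)$ with $N_\psi(Q)>Q$. $Q$ is $\mathcal E$-essential if $Q\in\mathcal E^r$ and $\langle\phi\in\mathrm{Aut}_{\mathcal E}(Q)\mid N_\phi(Q)>Q\rangle$ is proper in $\mathrm{Aut}_{\mathcal E}(Q)$. An $\mathcal E$-conjugacy representative of a collection $\mathfrak V$ of subgroups of $P$ is a subset $\mathfrak U\subseteq\mathfrak V$ such that each member of $\mathfrak V$ has exactly one $\mathcal E$-conjugate in $\mathfrak U$. An essential collection is a subset $\mathfrak E\subseteq\mathcal E^r$ of the form $\mathfrak E=\{Q\in\mathfrak U\mid Q\text{ is }\mathcal E\text{-essential}\}$ for some $\mathcal E$-conjugacy representative $\mathfrak U$ of $\mathcal E^r$. A main essential collection is an essential collection each member of which is fully normalized. *)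

(* Defs.v *)
From HB Require Import structures.
From mathcomp Require Import all_boot all_fingroup all_solvable.

Set Implicit Arguments.
Unset Strict Implicit.
Unset Printing Implicit Defensive.

Local Open Scope group_scope.

(* [fhom E A B f] says that the restriction of [f] to [A] is a morphism A -> B
   of the fusion system E on P. A morphism A -> B is represented by any function
   agreeing with it on A; [fhom_ext] makes the choice irrelevant.
   [fhom_iso]: every morphism is an isomorphism of the category followed by an
   inclusion. Restrictions are composites with the inclusions, which are given
   by [fhom_conj] at x = 1. *)
Record fusion_system (gT : finGroupType) (P : {group gT}) := FusionSystem {
  fhom : {group gT} -> {group gT} -> pred (gT -> gT);
  fhom_inj : forall (A B : {group gT}) (f : gT -> gT), fhom A B f ->
    [/\ A \subset P, B \subset P, morphic A f, {in A &, injective f}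
      & f @: A \subset B];
  fhom_ext : forall (A B : {group gT}) (f g : gT -> gT),
    {in A, f =1 g} -> fhom A B f -> fhom A B g;
  fhom_conj : forall (A B : {group gT}) (x : gT), x \in P ->
    A \subset P -> B \subset P -> A :^ x \subset B -> fhom A B (conjg^~ x);
  fhom_comp : forall (A B C : {group gT}) (f g : gT -> gT),
    fhom A B f -> fhom B C g -> fhom A C (g \o f);
  fhom_iso : forall (A B C : {group gT}) (f : gT -> gT),
    fhom A B f -> C = f @: A :> {set gT} ->
    fhom A C f /\ (forall g, {in A, cancel f g} -> fhom C A g)
}.

Section Fusion.
Variables (gT : finGroupType) (P : {group gT}) (E : fusion_system P).
Implicit Types (A B C Q R : {group gT}) (f g : gT -> gT).

Definition fiso Q R f := fhom E Q R f && (f @: Q == R).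

Definition fconj Q R := exists f, fiso Q R f.

Definition AutE Q : {set {perm gT}} := [set a in Aut Q | fhom E Q Q a].

Definition AutP Q : {set {perm gT}} := conj_aut Q @* 'N_P(Q).

Definition fully_normalized Q :=
  Q \subset P /\ forall R, fconj Q R -> #|'N_P(R)| <= #|'N_P(Q)|.

(* The condition phi^-1 c_x phi = c_y on Q phi, evaluated at z phi for z in Q. *)
Definition Nphi Q f : {set gT} :=
  [set x in 'N_P(Q) | [exists y in 'N_P(f @: Q),
                        [forall z in Q, f (z ^ x) == f z ^ y]]].

Lemma Nphi_group_set Q f : group_set (Nphi Q f).
Proof.
apply/group_setP; split=> [|x x'].
  rewrite in_set group1; apply/exists_inP; exists 1; first exact: group1.
  by apply/forall_inP=> z _; rewrite !conjg1.
rewrite in_set => /andP[Nx /exists_inP[y Ny /forall_inP Hy]].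
rewrite in_set => /andP[Nx' /exists_inP[y' Ny' /forall_inP Hy']].
rewrite in_set groupM //=; apply/exists_inP; exists (y * y').
  exact: groupM.
apply/forall_inP=> z Qz; rewrite !conjgM -(eqP (Hy z Qz)); apply: Hy'.
by rewrite memJ_norm //; case/setIP: Nx.
Qed.

Canonical Nphi_group Q f := Group (Nphi_group_set Q f).

Definition receptive Q :=
  Q \subset P /\
  forall R f, fiso R Q f ->
    exists2 g, fhom E (Nphi_group R f) P g & {in R, g =1 f}.

Definition reproductive R :=
  [/\ R \proper P, receptive R
    & forall Q, fconj R Q ->
        exists2 f, fhom E Q R f & Q \proper Nphi Q f].

Definition essential Q :=
  reproductive Q /\
  <<[set a in AutE Q | Q \proper Nphi Q a]>> \proper AutE Q.

Definition conjugacy_representative (V : {group gT} -> Prop)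
    (U : {set {group gT}}) :=
  (forall Q, Q \in U -> V Q) /\
  (forall Q, V Q -> exists! R, R \in U /\ fconj Q R).

Definition essential_collection (EE : {set {group gT}}) :=
  exists2 U, conjugacy_representative reproductive U
           & forall Q, Q \in EE <-> Q \in U /\ essential Q.

Definition main_essential_collection (EE : {set {group gT}}) :=
  essential_collection EE /\ forall Q, Q \in EE -> fully_normalized Q.

(* The morphisms of < Aut_E(Q) | Q in X >. *)
Inductive gen_fhom (X : {group gT} -> Prop) :
    {group gT} -> {group gT} -> (gT -> gT) -> Prop :=
  | gen_restr Q A B (a : {perm gT}) f :
      X Q -> a \in AutE Q -> A \subset Q -> B \subset Q ->
      a @: A \subset B -> {in A, f =1 a} -> gen_fhom X A B f
  | gen_comp A B C f g h :
      gen_fhom X A B f -> gen_fhom X B C g ->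
      {in A, h =1 g \o f} -> gen_fhom X A C h.

Definition fully_automized (p : nat) Q := p.-Sylow(AutE Q) (AutP Q).

(* Each subgroup is conjugate to a fully automized receptive one
   (Aschbacher-Kessar-Oliver). *)
Definition saturated (p : nat) :=
  forall Q, Q \subset P ->
    exists R, [/\ fconj Q R, fully_automized p R & receptive R].

Definition strongly_closed (D : {set gT}) :=
  D \subset P /\
  forall x f, x \in D -> fhom E <[x]> P f -> f x \in D.

End Fusion.

(* The overgroup S lives in a group type of its own, so that it is not confined
   to the ambient group of P; P is identified with its image under the
   injective morphism i, and the last clause says that E = F|_{<= P}. *)
Definition semisaturated (p : nat) (gT : finGroupType) (P : {group gT})
    (E : fusion_system P) :=
  exists (sT : finGroupType) (S : {group sT}) (F : fusion_system S)
         (i : {morphism P >-> sT}),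
    [/\ p.-group S, saturated F p, 'injm i, strongly_closed F (i @* P)
      & forall (A B : {group gT}) (f : gT -> gT) (g : sT -> sT),
          A \subset P -> B \subset P -> f @: A \subset B ->
          {in A, forall x, g (i x) = i (f x)} ->
          fhom E A B f = fhom F (i @* A) (i @* B) g].

(* Main.v *)
(* Every subgroup Q of P has an E-conjugate R that is receptive and to which each
   conjugate T is carried by a morphism defined on all of N_P(T). In a saturated
   system one takes R receptive and fully automized: by Sylow, an isomorphism
   T -> R can be corrected by an automorphism of R so that Aut_S(T) lands in
   Aut_S(R), and then it extends to N_S(T). The property passes to E = F|_{<= P}
   because morphisms of F map the strongly closed subgroup P into itself. By
   maximality of the normalizer, the property is then shared by every fully
   normalized conjugate; as normalizers grow in p-groups, fully normalized proper
   subgroups are reproductive, which gives the main essential collections.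

   Generation is by induction on |P| - |A|. For A < P, the reproductive
   representative R of the class of A receives both A and f(A) by isomorphisms
   that extend to larger subgroups, so f reduces to an automorphism of R. If R is
   not essential, that automorphism is a product of automorphisms that extend to
   larger subgroups. *)
Require Import Defs.
From mathcomp Require Import all_boot all_fingroup all_solvable.
From mathcomp Require Import boolp.

Set Implicit Arguments.
Unset Strict Implicit.
Unset Printing Implicit Defensive.

Section FusionTheory.
Local Open Scope group_scope.

Variables (gT : finGroupType) (P : {group gT}) (E : fusion_system P).
Implicit Types (A B C N Q R T : {group gT}) (f g h : gT -> gT).

(** * Morphisms, isomorphisms and automorphism groups of a fusion system *)

Lemma left_inverse_on (A : {set gT}) f :
  {in A &, injective f} -> exists g, {in A, cancel f g}.
Proof.
move=> injf; exists (fun y => odflt 1 [pick x in A | f x == y]) => x Ax.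
case: pickP => [z /andP[Az /eqP fzx] | /(_ x)]; last by rewrite /= Ax eqxx.
exact: injf.
Qed.

Lemma imset_group A f :
  morphic A f -> exists C : {group gT}, C = f @: A :> {set gT}.
Proof.
by move=> fM; exists (morphm fM @* A)%G; rewrite /= morphimEdom.
Qed.

Lemma fhom_id A B : A \subset B -> B \subset P -> fhom E A B id.
Proof.
move=> sAB sBP; apply: (@fhom_ext _ _ E A B (conjg^~ 1)) => [x _|].
  by rewrite conjg1.
by apply: fhom_conj; rewrite ?conjsg1 ?(subset_trans sAB).
Qed.

Lemma fhom_comp_ext A B C f g h :
  fhom E A B f -> fhom E B C g -> {in A, h =1 g \o f} -> fhom E A C h.
Proof.
move=> Ef Eg hE; apply: fhom_ext (fhom_comp Ef Eg) => x Ax.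
by rewrite hE.
Qed.

Lemma fhom_mem A B f : fhom E A B f -> {in A, forall x, f x \in B}.
Proof. by case/fhom_inj=> _ _ _ _ /subsetP sfB x Ax; rewrite sfB ?imset_f. Qed.

Lemma fhomJ A B f : fhom E A B f -> {in A &, {morph f : x y / x ^ y}}.
Proof.
case/fhom_inj=> _ _ fM _ _ x y Ax Ay.
by rewrite -(morphmE fM) morphJ.
Qed.

Lemma fhom_fiso A B f :
  fhom E A B f -> exists2 C : {group gT},
    C = f @: A :> {set gT} & fiso E A C f.
Proof.
move=> Ef; have [_ _ fM _ _] := fhom_inj Ef.
have [C defC] := imset_group fM; exists C => //.
by rewrite /fiso (fhom_iso Ef defC).1 defC eqxx.
Qed.

Lemma fhom_restrict A B A' B' f :
  fhom E A B f -> A' \subset A -> B' \subset P -> f @: A' \subset B' ->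
  fhom E A' B' f.
Proof.
move=> Ef sA'A sB'P sfB'; have [sAP sBP _ _ _] := fhom_inj Ef.
have Ef' : fhom E A' B f by apply: fhom_comp_ext (fhom_id sA'A sAP) Ef _.
have [C defC /andP[EfC _]] := fhom_fiso Ef'.
by apply: fhom_comp_ext EfC (fhom_id _ sB'P) _; rewrite // defC.
Qed.

Lemma fiso_fhom Q R f : fiso E Q R f -> fhom E Q R f.
Proof. by case/andP. Qed.

Lemma fiso_im Q R f : fiso E Q R f -> f @: Q = R.
Proof. by case/andP=> _ /eqP. Qed.

Lemma fiso_subl Q R f : fiso E Q R f -> Q \subset P.
Proof. by case/andP=> /fhom_inj[]. Qed.

Lemma fiso_subr Q R f : fiso E Q R f -> R \subset P.
Proof. by case/andP=> /fhom_inj[]. Qed.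

Lemma card_fiso Q R f : fiso E Q R f -> #|R| = #|Q|.
Proof.
case/andP=> /fhom_inj[_ _ _ injf _] /eqP <-.
by rewrite card_in_imset.
Qed.

Lemma fiso_sym Q R f :
  fiso E Q R f -> exists2 g, fiso E R Q g & {in Q, cancel f g}.
Proof.
case/andP=> Ef /eqP fQ; have [_ _ _ injf _] := fhom_inj Ef.
have [g fK] := left_inverse_on injf; exists g => //.
rewrite /fiso (fhom_iso Ef (esym fQ)).2 //= -fQ -imset_comp.
rewrite -[X in _ == X]imset_id; apply/eqP/eq_in_imset => x Qx /=.
exact: fK.
Qed.

Lemma fiso_comp A B C f g : fiso E A B f -> fiso E B C g -> fiso E A C (g \o f).
Proof.
case/andP=> Ef /eqP fA /andP[Eg /eqP gB].
by rewrite /fiso (fhom_comp Ef Eg) imset_comp fA gB eqxx.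
Qed.

Lemma fiso_endo Q f : fhom E Q Q f -> fiso E Q Q f.
Proof.
move=> Ef; rewrite /fiso Ef; have [_ _ _ injf sfQ] := fhom_inj Ef.
by rewrite eqEcard sfQ card_in_imset // leqnn.
Qed.

Lemma fconj_refl Q : Q \subset P -> fconj E Q Q.
Proof.
move=> sQP; exists id.
by rewrite /fiso fhom_id ?imset_id ?eqxx.
Qed.

Lemma fconj_sym Q R : fconj E Q R -> fconj E R Q.
Proof. by case=> f /fiso_sym[g isog _]; exists g. Qed.

Lemma fconj_trans Q R T : fconj E Q R -> fconj E R T -> fconj E Q T.
Proof. by case=> f isof [g isog]; exists (g \o f); apply: fiso_comp isog. Qed.

Lemma card_fconj Q R : fconj E Q R -> #|R| = #|Q|.
Proof. by case=> f /card_fiso. Qed.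

Lemma AutE_group_set Q : Q \subset P -> group_set (AutE E Q).
Proof.
move=> sQP; apply/group_setP; split=> [|a b].
  rewrite inE group1; apply: fhom_ext (fhom_id (subxx Q) sQP) => x _.
  by rewrite perm1.
case/setIdP=> Aa Ea /setIdP[Ab Eb]; rewrite inE groupM //=.
by apply: fhom_comp_ext Ea Eb _ => x _; rewrite /= permM.
Qed.

Lemma fhom_AutE Q f :
  fhom E Q Q f -> exists2 a, a \in AutE E Q & {in Q, f =1 a}.
Proof.
move=> Ef; have [_ _ fM injf sfQ] := fhom_inj Ef.
(* [perm_in] acts as [f] on [Q] and trivially elsewhere, as membership in [Aut Q] demands. *)
have aE := perm_inE injf sfQ; exists (perm_in injf sfQ) => [|x Qx]; last first.
  by rewrite aE.
rewrite !inE perm_in_on; apply/andP; split.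
  apply/morphicP=> x y Qx Qy; rewrite !aE ?groupM //.
  by apply: (morphicP fM).
by apply: fhom_ext Ef => x Qx; rewrite aE.
Qed.

(** * The groups [Nphi] and the domains of extensions *)

Lemma NphiP Q f x :
  reflect (x \in 'N_P(Q) /\
           exists2 y, y \in 'N_P(f @: Q)
                    & {in Q, forall z, f (z ^ x) = f z ^ y})
          (x \in Nphi P Q f).
Proof.
apply: (iffP setIdP) => -[Nx].
  case/exists_inP=> y Ny /forall_inP Hy; split=> //; exists y => // z Qz.
  exact/eqP/Hy.
case=> y Ny Hy; split=> //; apply/exists_inP; exists y => //.
by apply/forall_inP=> z Qz; rewrite Hy.
Qed.

Lemma fhom_norm Q N f x :
  fhom E N P f -> Q \subset N -> x \in N -> x \in 'N(Q) ->
  f x \in 'N_P(f @: Q).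
Proof.
move=> Ef /subsetP sQN Nx nQx; rewrite inE (fhom_mem Ef) // inE.
apply/subsetP=> _ /imsetP[_ /imsetP[z Qz ->] ->].
rewrite -(fhomJ Ef) ?(sQN z) //; apply: imset_f.
by rewrite memJ_norm.
Qed.

(** For [x] in [N] the witness asked for by [Nphi] is [f x], since [f] respects conjugation inside
    [N]. *)
Lemma Nphi_fhom Q N f :
  Q \subset N -> N \subset 'N_P(Q) -> fhom E N P f -> N \subset Nphi P Q f.
Proof.
move=> sQN sNN Ef; apply/subsetP=> x Nx.
have [Px nQx] := setIP (subsetP sNN x Nx).
apply/NphiP; split; first exact: (subsetP sNN).
exists (f x) => [|z Qz]; first exact: fhom_norm Ef sQN Nx nQx.
by rewrite (fhomJ Ef) // (subsetP sQN).
Qed.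

Lemma sub_Nphi Q f : fhom E Q P f -> Q \subset Nphi P Q f.
Proof.
move=> Ef; have [sQP _ _ _ _] := fhom_inj Ef.
by apply: Nphi_fhom Ef; rewrite // subsetI sQP normG.
Qed.

(** * Subgroups that receive the normalizers of all their conjugates *)

Definition normalizer_attracting R :=
  receptive E R /\
  forall Q, fconj E Q R -> exists2 f, fhom E 'N_P(Q) P f & f @: Q = R.

Lemma normalizer_subset Q : Q \subset P -> Q \subset 'N_P(Q).
Proof. by move=> sQP; rewrite subsetI sQP normG. Qed.

(** If [x] normalizes [Q], then [f x] normalizes [f @: Q], so the target shrinks from [P] to
    ['N_P(R)]. *)
Lemma normalizer_attracting_fiso R Q :
  normalizer_attracting R -> fconj E Q R ->
  exists2 f, fhom E 'N_P(Q) 'N_P(R) f & f @: Q = R.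
Proof.
move=> [_ attrR] QR; have [f Ef fQ] := attrR Q QR.
have sQP : Q \subset P by case: QR => ? /fiso_subl.
exists f => //; apply: (fhom_restrict Ef (subxx _) (subsetIl _ _)).
apply/subsetP=> _ /imsetP[x Nx ->]; rewrite -fQ.
apply: (fhom_norm Ef (normalizer_subset sQP) Nx).
by case/setIP: Nx.
Qed.

(** The injection of ['N_P(Q)] into ['N_P(R)] is onto because the normalizer of [Q] has maximal
    order. Its inverse brings morphisms into ['N_P(R)] back to ['N_P(Q)], which carries both clauses
    of the property over from [R] to [Q]. *)
Lemma normalizer_attracting_conj R Q :
  normalizer_attracting R -> fconj E Q R -> fully_normalized E Q ->
  normalizer_attracting Q.
Proof.
move=> attrR QR [sQP maxQ]; have RQ := fconj_sym QR.
have sRP : R \subset P by case: QR => ? /fiso_subr.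
have [f Ef fQ] := normalizer_attracting_fiso attrR QR.
have isof : fiso E 'N_P(Q) 'N_P(R) f.
  rewrite /fiso Ef; have [_ _ _ injf sfN] := fhom_inj Ef.
  by rewrite eqEcard sfN card_in_imset // maxQ.
have sQN := normalizer_subset sQP.
have [g isog fK] := fiso_sym isof; have Eg := fiso_fhom isog.
have gR : g @: R = Q.
  rewrite -fQ -imset_comp -[RHS]imset_id; apply: eq_in_imset => x Qx.
  exact/fK/(subsetP sQN).
split=> [|T TQ]; last first.
  have [h Eh hT] := normalizer_attracting_fiso attrR (fconj_trans TQ QR).
  exists (g \o h); last by rewrite imset_comp hT.
  apply: (fhom_comp Eh (fhom_restrict Eg (subxx _) (subxx P) _)).
  by case/fhom_inj: Eg => _ _ _ _ /subset_trans-> //; apply: subsetIl.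
split=> // T phi isophi; have [sTP phiT] := (fiso_subl isophi, fiso_im isophi).
have sTN : T \subset Nphi P T phi.
  apply: sub_Nphi; apply: fhom_restrict (fiso_fhom isophi) _ _ _ => //.
  by rewrite phiT.
have isofphi : fiso E T R (f \o phi).
  rewrite /fiso imset_comp phiT fQ eqxx andbT.
  apply: (fhom_comp (fiso_fhom isophi) (fhom_restrict Ef sQN sRP _)).
  by rewrite fQ.
have [_ /(_ T _ isofphi)[psi Epsi psiE]] := attrR.1.
(* If [y] realizes the action of [x] through [phi], then [f y] realizes it through [f \o phi]. So
   the extension [psi] of [f \o phi] is defined on [Nphi P T phi], with values in the domain of
   [g]. *)
have sNN : Nphi P T phi \subset Nphi P T (f \o phi).
  apply/subsetP=> x /NphiP[Nx [y]]; rewrite phiT => Ny Hy; apply/NphiP.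
  rewrite imset_comp phiT fQ; split=> //; exists (f y) => [|z Tz].
    exact: fhom_mem Ef y Ny.
  rewrite /= Hy // (fhomJ Ef) //.
  by rewrite (subsetP sQN) // -phiT imset_f.
have Epsi' : fhom E (Nphi_group P T phi) 'N_P(R) psi.
  apply: (fhom_restrict Epsi sNN (subsetIl _ _)).
  apply/subsetP=> _ /imsetP[x Nx ->].
  rewrite -(fiso_im isofphi) -(eq_in_imset psiE).
  apply: (fhom_norm Epsi (subset_trans sTN sNN) (subsetP sNN x Nx)).
  by case/setIdP: Nx => /setIP[].
exists (g \o psi) => [|x Tx].
  apply: (fhom_comp Epsi' (fhom_restrict Eg (subxx _) (subxx P) _)).
  by case/fhom_inj: Eg => _ _ _ _ /subset_trans-> //; apply: subsetIl.
by rewrite /= psiE //= fK // (subsetP sQN) // -phiT imset_f.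
Qed.

(** The attracting map lives on ['N_P(Q)], which is larger than [Q] because [P] is nilpotent and [Q]
    is proper. *)
Lemma normalizer_attracting_reproductive (p : nat) R :
  p.-group P -> R \proper P -> normalizer_attracting R -> reproductive E R.
Proof.
move=> pP prR attrR; split=> // [|Q RQ]; first by case: attrR.
have QR := fconj_sym RQ; have [f Ef fQ] := normalizer_attracting_fiso attrR QR.
have sQP : Q \subset P by case: QR => ? /fiso_subl.
have sQN := normalizer_subset sQP.
exists f.
  by apply: (fhom_restrict Ef sQN); rewrite ?fQ // proper_sub.
have prQ : Q \proper P by rewrite properEcard sQP -(card_fconj QR) proper_card.
have EfP : fhom E 'N_P(Q) P f.
  apply: (fhom_restrict Ef (subxx _) (subxx _)).
  by case/fhom_inj: Ef => _ _ _ _ /subset_trans-> //; apply: subsetIl.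
apply: proper_sub_trans (Nphi_fhom sQN (subxx _) EfP).
exact: nilpotent_proper_norm (pgroup_nil pP) prQ.
Qed.

(** * Fully normalized representatives and main essential collections *)

Lemma fully_normalized_exists Q :
  Q \subset P -> exists2 R, fconj E Q R & fully_normalized E R.
Proof.
move=> sQP; pose C := [pred R : {group gT} | `[<fconj E Q R>]].
have CQ : C Q by apply/asboolP/fconj_refl.
case: (arg_maxnP (fun R : {group gT} => #|'N_P(R)|) CQ) => R /asboolP QR maxR.
exists R => //; split=> [|T RT]; first by case: QR => ? /fiso_subr.
by apply/maxR/asboolP/(fconj_trans QR).
Qed.

Lemma fully_normalized_reproductive (p : nat) R :
  p.-group P ->
  (forall Q, Q \subset P -> exists2 T, fconj E Q T & normalizer_attracting T) ->
  R \proper P -> fully_normalized E R -> reproductive E R.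
Proof.
move=> pP exattr prR fnR; apply: (normalizer_attracting_reproductive pP) => //.
have [T RT attrT] := exattr R (proper_sub prR).
exact: normalizer_attracting_conj attrT RT fnR.
Qed.

Lemma main_essential_collection_exists (p : nat) :
  p.-group P ->
  (forall Q, Q \subset P -> exists2 T, fconj E Q T & normalizer_attracting T) ->
  exists EE : {set {group gT}}, main_essential_collection E EE.
Proof.
move=> pP exattr.
(* A choice of fully normalized conjugate; the default is never reached for [Q] inside [P]. *)
pose rep Q := odflt Q
  [pick R : {group gT} | `[<fconj E Q R /\ fully_normalized E R>]].
have repP Q : Q \subset P -> fconj E Q (rep Q) /\ fully_normalized E (rep Q).
  move=> sQP; rewrite /rep; case: pickP => [R /asboolP // | noR].
  have [R QR fnR] := fully_normalized_exists sQP.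
  by have /asboolP[] := noR R.
(* Conjugate subgroups present [pick] with the same predicate, hence get the same choice. The
   uniqueness of representatives rests on this. *)
have rep_conj Q R : fconj E Q R -> rep Q = rep R.
  move=> QR; have sRP : R \subset P by case: QR => ? /fiso_subr.
  rewrite /rep (@eq_pick _ _
    (fun T => `[<fconj E R T /\ fully_normalized E T>])).
    case: pickP => // noT; have [T RT fnT] := fully_normalized_exists sRP.
    by have /asboolP[] := noT T.
  move=> T /=; apply/asbool_equiv_eq; split=> -[cT fnT]; split=> //.
    exact: fconj_trans (fconj_sym QR) cT.
  exact: fconj_trans QR cT.
have proper_conj Q R : Q \proper P -> fconj E Q R -> R \proper P.
  move=> prQ QR; rewrite properEcard (card_fconj QR) proper_card // andbT.
  by case: QR => ? /fiso_subr.
pose U := [set R : {group gT} | (R \proper P) && (rep R == R)].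
pose EE := [set R in U | `[<essential E R>]].
have UP R : R \in U -> [/\ R \proper P, rep R = R & fully_normalized E R].
  rewrite inE => /andP[prR /eqP repR]; split=> //.
  by rewrite -repR; apply: (repP R (proper_sub prR)).2.
exists EE; split=> [|Q]; last by rewrite inE => /andP[/UP[]].
exists U => [|Q]; last first.
  rewrite inE; split=> [/andP[UQ /asboolP] // | [-> essQ]].
  exact/asboolP.
split=> [Q /UP[prQ _ fnQ] | Q [prQ _ _]].
  exact: fully_normalized_reproductive pP exattr prQ fnQ.
have [cQ fnQ] := repP Q (proper_sub prQ); exists (rep Q); split.
  by split=> //; rewrite inE (proper_conj Q) //= -(rep_conj _ _ cQ).
by move=> R [/UP[_ repR _] QR]; rewrite -repR; apply: rep_conj.
Qed.

(** * Generation by automorphism groups *)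

Lemma gen_fhom_sound (X : {group gT} -> Prop) A B f :
  (forall Q, X Q -> Q \subset P) -> gen_fhom E X A B f -> fhom E A B f.
Proof.
move=> XP; elim=> {A B f}
    [Q A B a f XQ Ea sAQ sBQ saB fa | A B C f g h _ Ef _ Eg hE].
  apply: (@fhom_ext _ _ _ _ _ a) => [x Ax|]; first by rewrite fa.
  have /setIdP[_ EQa] := Ea.
  exact: fhom_restrict EQa sAQ (subset_trans sBQ (XP _ XQ)) saB.
exact: fhom_comp_ext Ef Eg hE.
Qed.

Section Generation.
Variable X : {group gT} -> Prop.
Hypothesis XsubP : forall Q, X Q -> Q \subset P.
Hypothesis XP : X P.

Let gen := gen_fhom E X.

Lemma gen_fhom_incl A B f :
  A \subset B -> B \subset P -> {in A, f =1 id} -> gen A B f.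
Proof.
move=> sAB sBP fid; apply: (@gen_restr _ _ E X P A B 1) => //.
- exact: group1 (Group (AutE_group_set (subxx P))).
- exact: subset_trans sBP.
- by apply/subsetP=> _ /imsetP[x Ax ->]; rewrite perm1 (subsetP sAB).
by move=> x Ax; rewrite perm1 fid.
Qed.

Lemma gen_fhom_ext A B f g : {in A, f =1 g} -> gen A B f -> gen A B g.
Proof.
move=> fg genf; have [sAP _ _ _ _] := fhom_inj (gen_fhom_sound XsubP genf).
apply: (gen_comp (gen_fhom_incl (subxx A) sAP (fun _ _ => erefl)) genf).
by move=> x Ax; rewrite /= fg.
Qed.

Lemma gen_fhom_restrict A B A' B' f :
  gen A B f -> A' \subset A -> B' \subset P -> f @: A' \subset B' ->
  gen A' B' f.
Proof.
move=> genf; elim: genf A' B' => {A B f}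
    [Q A B a f XQ Ea sAQ sBQ saB fa | A B C f g h genf IHf geng IHg hE]
    A' B' sA'A sB'P sfB'.
  have fa' : {in A', f =1 a} by move=> x /(subsetP sA'A)/fa.
  rewrite (eq_in_imset fa') in sfB'.
  have /setIdP[_ EQa] := Ea.
  have Ea' : fhom E A' P a.
    apply: fhom_restrict EQa (subset_trans sA'A sAQ) (subxx P) _.
    exact: subset_trans sfB' sB'P.
  (* [gen_restr] wants a target inside [Q], which [B'] need not be. So [a] is first taken onto its
     image [C], and the inclusion of [C] in [B'] comes from the identity of [P]. *)
  have [C defC isoa] := fhom_fiso Ea'; rewrite -defC in sfB'.
  have sCQ : C \subset Q.
    by rewrite defC (subset_trans (imsetS _ sA'A)) // (subset_trans saB).
  have gena : gen A' C a.
    by apply: gen_restr XQ Ea _ sCQ _ _; rewrite ?(subset_trans sA'A) ?defC.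
  exact: (gen_comp gena (gen_fhom_incl sfB' sB'P (fun _ _ => erefl))).
have Ef := gen_fhom_sound XsubP genf.
have [_ sBP _ _ sfB] := fhom_inj Ef.
have sfB1 : f @: A' \subset B by apply: subset_trans (imsetS _ sA'A) sfB.
have [D defD _] := fhom_fiso (fhom_restrict Ef sA'A sBP sfB1).
have sDB : D \subset B by rewrite defD.
have hE' : {in A', h =1 g \o f} by move=> x /(subsetP sA'A)/hE.
apply: (gen_comp (IHf A' D sA'A _ _) (IHg D B' sDB sB'P _) hE').
- exact: subset_trans sBP.
- by rewrite defD.
by rewrite defD -imset_comp -(eq_in_imset hE').
Qed.

(** The form in which an essential collection enters: a chosen representative outside it is not
    essential. *)
Hypothesis Xrep : forall Q, Q \proper P ->
  exists R, [/\ fconj E Q R, reproductive E R & X R \/ ~ essential E R].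

Lemma gen_fhom_complete A B f : fhom E A B f -> gen A B f.
Proof.
have [n] := ubnP (#|P| - #|A|); elim: n => // n IHn in A B f *.
rewrite ltnS => leAn Ef; have [sAP sBP _ _ sfB] := fhom_inj Ef.
have [A1 defA1 isof] := fhom_fiso Ef.
suffices genf : gen A A1 f.
  apply: gen_comp genf (@gen_fhom_incl A1 B id _ sBP _) _ => //.
  by rewrite defA1.
have [prA | /negPf nprA] := boolP (A \proper P); last first.
  have defA : A = P by apply/val_inj/eqP; rewrite eqEproper sAP nprA.
  have defA1P : A1 = P.
    apply/val_inj/eqP; rewrite eqEcard (fiso_subr isof) (card_fiso isof).
    by rewrite defA leqnn.
  move: isof; rewrite defA defA1P => isof.
  have [a Ea fa] := fhom_AutE (fiso_fhom isof).
  apply: (gen_restr XP Ea) => //.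
  by rewrite -(eq_in_imset fa) (fiso_im isof).
have [R [AR repR XR]] := Xrep prA.
have [prR [_ recR] attrR] := repR.
(* Conjugates of [A] have the order of [A], so a morphism defined on a subgroup [N] properly
   containing one of them falls under the induction hypothesis. *)
have IH Q T N g : fconj E A Q -> Q \proper N -> fhom E N P g ->
    T \subset P -> g @: Q \subset T -> gen Q T g.
  move=> AQ ltQN Eg sTP sgT; have [sNP _ _ _ _] := fhom_inj Eg.
  have genN : gen N P g.
    apply: IHn Eg; apply: leq_trans leAn.
    rewrite -(card_fconj AQ) ltn_sub2l ?(proper_card ltQN) //.
    exact: leq_trans (proper_card ltQN) (subset_leq_card sNP).
  exact: gen_fhom_restrict genN (proper_sub ltQN) sTP sgT.
have sRP := proper_sub prR; have RA := fconj_sym AR.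
(* Receptivity of [R] extends [g] to [Nphi P Q g]. The inverse of [g] is handled separately: it
   extends to the image [M] of that extension, and [M] properly contains [R] by counting. *)
have gen_ext Q g : fiso E Q R g -> Q \proper Nphi P Q g ->
    gen Q R g /\ exists2 g', gen R Q g' & {in Q, cancel g g'}.
  move=> isog ltQN; have RQ : fconj E R Q by apply: fconj_sym; exists g.
  have [gb Egb gbE] := recR Q g isog; have sQN := proper_sub ltQN.
  have gbQ : gb @: Q = R by rewrite (eq_in_imset gbE) (fiso_im isog).
  split.
    apply: gen_fhom_ext gbE _; apply: (IH Q R _ gb _ ltQN Egb) => //.
      exact: fconj_trans AR RQ.
    by rewrite gbQ.
  have [M defM isogb] := fhom_fiso Egb; have [gc isogc gbK] := fiso_sym isogb.
  exists gc => [|x Qx]; last by rewrite -gbE // gbK ?(subsetP sQN).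
  have gcR : gc @: R = Q.
    rewrite -gbQ -imset_comp -[RHS]imset_id; apply: eq_in_imset => x Qx.
    exact/gbK/(subsetP sQN).
  have ltRM : R \proper M.
    rewrite properEcard -{1}gbQ defM imsetS //= -defM (card_fiso isogb).
    by rewrite -(card_fconj RQ) proper_card.
  apply: (IH R Q M gc AR ltRM) => //; last by rewrite gcR.
  - apply: (fhom_restrict (fiso_fhom isogc)) => //.
    by rewrite (fiso_im isogc) (fiso_subr isogc).
  - exact: fiso_subl isog.
have attr Q : fconj E R Q ->
    exists g, [/\ fiso E Q R g, gen Q R g
                & exists2 g', gen R Q g' & {in Q, cancel g g'}].
  move=> RQ; have [g Eg ltQN] := attrR Q RQ; exists g.
  have isog : fiso E Q R g.
    rewrite /fiso Eg; have [_ _ _ injg sgR] := fhom_inj Eg.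
    by rewrite eqEcard sgR card_in_imset // (card_fconj RQ) leqnn.
  by have [] := gen_ext Q g isog ltQN.
have genR m : fhom E R R m -> gen R R m.
  case/fhom_AutE=> a Ea ma; apply: (@gen_fhom_ext _ _ a) => [x Rx|].
    by rewrite ma.
  have {ma m}genXR : X R -> gen R R a.
    move=> XR'; apply: (gen_restr XR' Ea) => //.
    by have /setIdP[_ /fhom_inj[]] := Ea.
  case: XR => // nessR.
  (* The generated automorphisms form a group containing those that extend, and the latter generate
     all of [AutE E R] when [R] is not essential. *)
  pose G : {set {perm gT}} := [set b : {perm gT} | `[<gen R R b>]].
  have GG : group_set G.
    apply/group_setP; split=> [|b c]; rewrite !inE.
      by apply/asboolP; apply: gen_fhom_incl => // x _; rewrite perm1.
    move=> /asboolP genb /asboolP genc; apply/asboolP.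
    by apply: (gen_comp genb genc) => x _; rewrite /= permM.
  have sAG : AutE E R \subset Group GG.
    have sgenA :
        <<[set b in AutE E R | R \proper Nphi P R b]>> \subset AutE E R.
      rewrite (gen_subG _ (Group (AutE_group_set sRP))).
      by apply/subsetP=> b /setIdP[].
    have /negPn : ~~ ~~ (AutE E R \subset
        <<[set b in AutE E R | R \proper Nphi P R b]>>).
      by apply/negP=> nsub; apply: nessR; split=> //; rewrite properE sgenA.
    move/subset_trans; apply; rewrite gen_subG; apply/subsetP=> b.
    case/setIdP=> /setIdP[_ Eb] ltRN; rewrite inE; apply/asboolP.
    by have [] := gen_ext R b (fiso_endo Eb) ltRN.
  by have := subsetP sAG a Ea; rewrite inE => /asboolP.
have [f1 [isof1 genf1 _]] := attr A RA.
have [f2 [isof2 _ [g2 geng2 f2K]]] :=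
  attr A1 (fconj_trans RA (ex_intro _ f isof)).
have [g1 isog1 f1K] := fiso_sym isof1.
(* On [A], the map [f] is [f1] followed by the endomorphism [m] of [R] and by the inverse [g2] of
   [f2]. *)
pose m := f2 \o (f \o g1).
have genm : gen R R m.
  apply: genR; apply: fhom_comp (fiso_fhom isof2).
  exact: fhom_comp (fiso_fhom isog1) (fiso_fhom isof).
apply: (gen_comp genf1 (gen_comp genm geng2 (fun _ _ => erefl))) => x Ax.
by rewrite /= /m /= f1K // f2K // defA1 imset_f.
Qed.

End Generation.

(** * Attracting subgroups in a saturated system *)

Lemma saturated_attracting (p : nat) Q :
  p.-group P -> saturated E p -> Q \subset P ->
  exists2 R, fconj E Q R & normalizer_attracting R.
Proof.
move=> pP satE sQP; have [R [QR autR recR]] := satE Q sQP; exists R => //.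
split=> // T [phi isophi].
have [Ephi phiT] := (fiso_fhom isophi, fiso_im isophi).
have [sTP sRP phiM inj_phi _] := fhom_inj Ephi.
have inj_phi' : 'injm (morphm phiM) by apply/injmP.
have phiMT : morphm phiM @* T = R by rewrite morphimEdom.
(* [kap] transports automorphisms along [phi], so [K] is the copy in [Aut R] of the automorphisms
   that ['N_P(T)] induces on [T]. *)
pose kap := Aut_isom inj_phi' (subxx T).
pose K := kap @* (conj_aut T @* 'N_P(T)).
have kapE x z : x \in 'N_P(T) -> z \in T ->
    kap (conj_aut T x) (phi z) = phi (z ^ x).
  case/setIP=> Px nTx Tz.
  have Ax : conj_aut T x \in Aut T by apply: Aut_aut.
  have := Aut_isomE inj_phi' (subxx T) Ax Tz.
  by rewrite /= norm_conj_autE.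
have pK : p.-group K.
  by do 2!apply: morphim_pgroup; apply: pgroupS (subsetIl _ _) pP.
have [phi' isophi' phiK] := fiso_sym isophi.
have sKA : K \subset Group (AutE_group_set sRP).
  apply/subsetP=> _ /morphimP[a _ /morphimP[x nTx Nx ->] ->] /=.
  rewrite inE -phiMT Aut_Aut_isom /=.
  have Ex : fhom E T T (conjg^~ x).
    by case/setIP: Nx => Px /normP nTx'; apply: fhom_conj; rewrite // nTx'.
  apply: fhom_ext (fhom_comp (fhom_comp (fiso_fhom isophi') Ex) Ephi).
  rewrite -phiT => _ /imsetP[z Tz ->] /=.
  by rewrite phiK // -(kapE x z Nx Tz).
have sylR :
  p.-Sylow(Group (AutE_group_set sRP)) (conj_aut R @* 'N_P(R)) := autR.
have [al /setIdP[_ Eal] sKal] := Sylow_Jsub sylR sKA pK.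
pose psi := al \o phi.
have isopsi : fiso E T R psi := fiso_comp isophi (fiso_endo Eal).
have [_ /(_ T psi isopsi)[g Eg gpsi]] := recR.
(* After correction by [al], the transported action of each [x] lies in [AutP P R], so it is
   conjugation by some [y] in ['N_P(R)]. *)
have sNN : 'N_P(T) \subset Nphi P T psi.
  apply/subsetP=> x Nx; apply/NphiP; split=> //; rewrite (fiso_im isopsi).
  have Kx : kap (conj_aut T x) ^ al \in K :^ al.
    rewrite memJ_conjg; apply: mem_morphim; first exact: Aut_aut.
    by apply: mem_morphim => //; case/setIP: Nx.
  have /morphimP[y nRy Ny kapy] := subsetP sKal _ Kx.
  exists y => // z Tz.
  have Rz : psi z \in R by apply: fhom_mem (fiso_fhom isopsi) z Tz.
  by rewrite -(norm_conj_autE nRy Rz) -kapy /psi /= permJ kapE.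
exists g; last by rewrite (eq_in_imset gpsi) (fiso_im isopsi).
apply: (fhom_restrict Eg) => //.
apply: subset_trans (imsetS _ sNN) _.
by case/fhom_inj: Eg.
Qed.

End FusionTheory.

(** * Passage from a saturated system to a strongly closed subgroup *)

Section Transfer.
Local Open Scope group_scope.

Variables (gT sT : finGroupType) (P : {group gT}) (S : {group sT}).
Variables (E : fusion_system P) (F : fusion_system S).
Variable i : {morphism P >-> sT}.
Hypothesis inj_i : 'injm i.
Hypothesis closed : strongly_closed F (i @* P).
Hypothesis EF : forall (A B : {group gT}) (f : gT -> gT) (g : sT -> sT),
  A \subset P -> B \subset P -> f @: A \subset B ->
  {in A, forall x, g (i x) = i (f x)} ->
  fhom E A B f = fhom F (i @* A) (i @* B) g.
Implicit Types (A B N Q R : {group gT}).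

Let lift (f : gT -> gT) := i \o f \o invm inj_i.
Let lower (g : sT -> sT) := invm inj_i \o g \o i.

Lemma liftE f x : x \in P -> lift f (i x) = i (f x).
Proof. by move=> Px; rewrite /lift /= invmE. Qed.

Lemma fhom_lift A B f : fhom E A B f -> fhom F (i @* A) (i @* B) (lift f).
Proof.
move=> Ef; have [sAP sBP _ _ sfB] := fhom_inj Ef.
by rewrite -(EF sAP sBP sfB) // => x Ax; rewrite liftE // (subsetP sAP).
Qed.

(** Strong closure speaks of single elements, so [g] is restricted to each cyclic subgroup
    [<[y]>]. *)
Lemma fhom_closed (B : {group sT}) A g :
  A \subset P -> fhom F (i @* A) B g -> g @: (i @* A) \subset i @* P.
Proof.
move=> sAP Fg; apply/subsetP=> _ /imsetP[y Ay ->]; apply: closed.2.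
  exact: subsetP (morphimS i sAP) y Ay.
have sxA : <[y]> \subset i @* A by rewrite cycle_subG.
have [_ sBS _ _ sgB] := fhom_inj Fg.
apply: (fhom_restrict Fg) => //.
exact: subset_trans (imsetS g sxA) (subset_trans sgB sBS).
Qed.

Lemma lowerE (B : {group sT}) A g :
  A \subset P -> fhom F (i @* A) B g ->
  {in A, forall x, i (lower g x) = g (i x)}.
Proof.
move=> sAP Fg x Ax; rewrite /lower /= invmK //.
apply: subsetP (fhom_closed sAP Fg) _ _; rewrite imset_f // mem_morphim //.
exact: subsetP sAP x Ax.
Qed.

Lemma fhom_lower A B g :
  A \subset P -> B \subset P -> fhom F (i @* A) (i @* B) g ->
  fhom E A B (lower g).
Proof.
move=> sAP sBP Fg; have lE := lowerE sAP Fg.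
rewrite (EF sAP sBP _ (fun x Ax => esym (lE x Ax))) //.
apply/subsetP=> _ /imsetP[x Ax ->].
have Px := subsetP sAP x Ax.
have /morphimP[y Py By gx] := fhom_mem Fg (mem_morphim i Px Ax).
by rewrite /lower /= gx invmE.
Qed.

Lemma imset_morphim A f g :
  A \subset P -> f @: A \subset P -> {in A, forall x, g (i x) = i (f x)} ->
  g @: (i @* A) = i @* (f @: A).
Proof.
move=> sAP sfP gif; rewrite !morphimEsub // -!imset_comp.
exact: eq_in_imset.
Qed.

Lemma fiso_lift A B f : fiso E A B f -> fiso F (i @* A) (i @* B) (lift f).
Proof.
move=> isof; have [sAP sBP] := (fiso_subl isof, fiso_subr isof).
have lE : {in A, forall x, lift f (i x) = i (f x)}.
  by move=> x Ax; rewrite liftE // (subsetP sAP).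
rewrite /fiso (fhom_lift (fiso_fhom isof)) /= (imset_morphim _ _ lE) //.
  by rewrite (fiso_im isof).
by rewrite (fiso_im isof).
Qed.

(** Brings extensions found in [F] down to [E]: strong closure keeps the image of [N] inside
    [i @* P], where [EF] applies. *)
Lemma descend (N' : {group sT}) N g :
  N \subset P -> i @* N \subset N' -> fhom F N' S g ->
  exists2 h, fhom E N P h & {in N, forall x, g (i x) = i (h x)}.
Proof.
move=> sNP sNN' Fg.
have Fg1 : fhom F (i @* N) S g.
  by have [_ _ _ _ sgS] := fhom_inj Fg; apply: (fhom_restrict Fg) => //;
     apply: subset_trans (imsetS g sNN') sgS.
have sPS : i @* P \subset S by case: closed.
have Fg2 : fhom F (i @* N) (i @* P) g.
  by apply: (fhom_restrict Fg1) => //; apply: fhom_closed Fg1.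
exists (lower g); first exact: fhom_lower.
by move=> x Nx; rewrite (lowerE sNP Fg1).
Qed.

(** By strong closure [T] is the image of a subgroup [R] of [P], and [R] is conjugate to [Q] in [E].
    The extensions that [T] provides for lifted maps then descend to [E]. *)
Lemma transfer_attracting Q T :
  Q \subset P -> fconj F (i @* Q) T -> normalizer_attracting F T ->
  exists2 R, fconj E Q R & normalizer_attracting E R.
Proof.
have sPS : i @* P \subset S by case: closed.
move=> sQP [phi isophi] [[_ recT] attrT].
have Fphi := fiso_fhom isophi; have defT := fiso_im isophi.
have FphiS : fhom F (i @* Q) S phi.
  by apply: (fhom_restrict Fphi) => //; rewrite defT (fiso_subr isophi).
have [f Ef phif] := descend sQP (subxx _) FphiS.
have [_ _ _ _ sfP] := fhom_inj Ef; have [R defR isof] := fhom_fiso Ef.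
have sRP : R \subset P by rewrite defR.
have iRT : (i @* R)%G = T.
  by apply: val_inj; rewrite /= defR -(imset_morphim sQP sfP phif) defT.
have isoT A h : fiso E A R h -> fiso F (i @* A) T (lift h).
  by move/fiso_lift; rewrite iRT.
have sNN A : i @* 'N_P(A) \subset 'N_S(i @* A).
  rewrite subsetI (subset_trans (morphimS i (subsetIl _ _))) //.
  exact: subset_trans (morphimS i (subsetIr _ _)) (morphim_norm i A).
exists R; first by exists f.
split=> [|A [h isoh]].
  split=> // A h isoh; have [sAP hA] := (fiso_subl isoh, fiso_im isoh).
  have [g Fg gE] := recT _ _ (isoT A h isoh).
  (* If [y] is a witness for [x], then [i y] is one for [i x]; hence the extension [g] in [F] covers
     the image of [Nphi P A h]. *)
  have sNphi : i @* Nphi P A h \subset Nphi S (i @* A) (lift h).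
    apply/subsetP=> _ /morphimP[x Px /NphiP[Nx [y Ny Hxy]] ->].
    rewrite hA in Ny.
    apply/NphiP; split; first by apply: (subsetP (sNN A)); apply: mem_morphim.
    have Py : y \in P by case/setIP: Ny.
    exists (i y) => [|_ /morphimP[z Pz Az ->]].
      rewrite (fiso_im (isoT A h isoh)) -iRT.
      by apply: (subsetP (sNN R)); apply: mem_morphim.
    rewrite -morphJ // !liftE ?groupJ // Hxy // morphJ //.
    by rewrite (subsetP sRP) // -hA imset_f.
  have sNP : Nphi_group P A h \subset P.
    by apply/subsetP=> x /NphiP[/setIP[]].
  have [k Ek gk] := descend sNP sNphi Fg; exists k => // x Ax.
  have Px := subsetP sAP x Ax.
  have hx : h x \in P by rewrite (subsetP sRP) // -hA imset_f.
  have Nx : x \in Nphi P A h.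
    apply: subsetP (sub_Nphi _) _ Ax.
    apply: (fhom_restrict (fiso_fhom isoh)) => //.
    by rewrite hA.
  apply: (injmP inj_i) => //; first exact: fhom_mem Ek x Nx.
  by rewrite -gk // gE ?mem_morphim // liftE.
have sAP := fiso_subl isoh; have sAN := normalizer_subset sAP.
have [g Fg gA] := attrT _ (ex_intro _ (lift h) (isoT A h isoh)).
have [k Ek gk] := descend (subsetIl P _) (sNN A) Fg; exists k => //.
have gkA : {in A, forall x, g (i x) = i (k x)}.
  by move=> x /(subsetP sAN); apply: gk.
have skP : k @: A \subset P.
  by case/fhom_inj: Ek => _ _ _ _; apply: subset_trans (imsetS k sAN).
apply: (injm_morphim_inj inj_i) => //.
by rewrite -(imset_morphim sAP skP gkA) gA -iRT.
Qed.

End Transfer.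

Theorem theorem3p14 (p : nat) (gT : finGroupType) (P : {group gT})
    (E : fusion_system P) (hp : prime p) (hP : (p.-group P)%g)
    (hE : semisaturated p E) :
  (exists EE : {set {group gT}}, main_essential_collection E EE) /\
  (forall EE : {set {group gT}}, main_essential_collection E EE ->
     forall (A B : {group gT}) (f : gT -> gT),
       fhom E A B f <->
       gen_fhom E (fun Q : {group gT} => Q \in EE \/ Q = P) A B f).
Proof.
have attr (Q : {group gT}) : Q \subset P ->
    exists2 R, fconj E Q R & normalizer_attracting E R.
  have [sT [S [F [i [pS satF inj_i clF EF]]]]] := hE.
  move=> sQP; have siQS : (i @* Q)%g \subset S.
    by case: clF => sPS _; apply: subset_trans (morphimS i sQP) sPS.
  have [T QT attrT] := saturated_attracting pS satF siQS.
  exact: transfer_attracting inj_i clF EF Q T sQP QT attrT.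
split=> [|EE [[U [UV Urep] EEU] _] A B f].
  exact: main_essential_collection_exists hP attr.
set X := fun Q : {group gT} => _.
have XP (Q : {group gT}) : X Q -> Q \subset P.
  by case=> [/EEU[/UV[/proper_sub]] | ->].
split; last exact: gen_fhom_sound.
apply: gen_fhom_complete => // [|Q prQ]; first by right.
(* [U] represents reproductive subgroups, and [Q] may fail to be one; its fully normalized conjugate
   [T] is. *)
have [T QT fnT] := fully_normalized_exists E (proper_sub prQ).
have prT : T \proper P.
  by rewrite properEcard fnT.1 (card_fconj QT) proper_card.
have [R [[UR TR] _]] := Urep T (fully_normalized_reproductive hP attr prT fnT).
exists R; split; [exact: fconj_trans QT TR | exact: UV | ].
have [EER | nEER] := boolP (R \in EE); first by left; left.
by right=> essR; case/negP: nEER; apply/EEU.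
Qed.
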